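(* Suppose $Q=\{\mathbf{x}\in\mathbb{R}^n:(\mathbf{x}-\mathbf{c})^T[I-\epsilon^2\mathbf{v}\mathbf{v}^T](\mathbf{x}-\mathbf{c})=a^2-c^2\}$ is a hyperboloid in $\mathbb{R}^n$ centered at $\mathbf{c}$, with axis vector $\mathbf{v}$ of unit length, eccentricity $\epsilon>1$, and parameters $a$ and $c$, and suppose $H\!P=\{\mathbf{x}\in\mathbb{R}^n:\mathbf{h}\cdot(\mathbf{x}-\mathbf{c})=\hat h\}$ is a hyperplane with $\|\mathbf{h}\|=1$. Let $\sigma=\mathbf{h}\cdot\mathbf{v}$, $\rho=\sqrt{1-\sigma^2}$, and let $\mathbf{g}_1$ be the unit vector defined in the context. (i) If $H\!P\cap Q$ is a hyperboloid or an ellipsoid (of dimension $n-1$), then its vectors are: axis vector $\mathbf{g}_1$, center $\hat{\mathbf{c}}=\mathbf{c}+\hat h\mathbf{h}+\tilde c\,\mathbf{g}_1$, vertices $\hat{\mathbf{a}}=\hat{\mathbf{c}}\pm\hat a\,\mathbf{g}_1$, and focal points $\hat{\mathbf{c}}\pm\hat a\,\epsilon\rho\,\mathbf{g}_1$, where $\tilde c$ and its parameters $\hat a$ and $\hat b$ are given by $$\tilde c=\frac{\epsilon^2\rho\sigma\hat h}{1-\epsilon^2\rho^2},\qquad \hat a^2=\frac{(1-\epsilon^2)\,[a^2(1-\epsilon^2\rho^2)-\hat h^2]}{(1-\epsilon^2\rho^2)^2},\qquad \tilde b=\hat a^2(1-\epsilon^2\rho^2),$$ with $\hat b^2=-\tilde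 b$ for a hyperboloid and $\hat b^2=\tilde b$ for an ellipsoid. (ii) If $H\!P\cap Q$ is a paraboloid (of dimension $n-1$), then its vectors are: axis vector $\mathbf{g}_1$, center $\hat{\mathbf{c}}=\mathbf{c}+\hat h\mathbf{h}+\hat c\,\mathbf{g}_1$, and focal points $\hat{\mathbf{c}}\pm\tilde c\,\mathbf{g}_1$, where $$\tilde c=\frac{\epsilon\sigma\hat h}{2},\qquad \hat c=\frac{(1-\epsilon^2\sigma^2)\hat h^2-(a^2-c^2)}{4\tilde c}.$$
   Context: Norms are Euclidean. The parameters of $Q$ satisfy $0<a<c$ and $\epsilon=c/a$. The vector $\mathbf{g}_1$ is $\mathbf{g}_1=(\mathbf{v}-\hat{\mathbf{g}})/\|\mathbf{v}-\hat{\mathbf{g}}\|$, where $\hat{\mathbf{g}}=(\mathbf{v}\cdot\mathbf{h})\mathbf{h}$ is the projection of $\mathbf{v}$ onto $\mathbf{h}$; it is defined when $\mathbf{h}$ and $\mathbf{v}$ are linearly independent, is orthogonal to $\mathbf{h}$, and satisfies $\mathbf{g}_1\cdot\mathbf{v}=\rho>0$. Conic sections of dimension $n-1$ are taken inside a hyperplane $A$ of $\mathbb{R}^n$: - The hyperboloid with focal points $\mathbf{q}_1,\mathbf{q}_2\in A$ and parameter $\alpha$, $0<2\alpha<\|\mathbf{q}_1-\mathbf{q}_2\|$, is $\{\mathbf{x}\in A:|\,\|\mathbf{q}_2-\mathbf{x}\|-\|\mathbf{q}_1-\mathbf{x}\|\,|=2\alpha\}$. - The ellipsoid with focal points $\mathbf{q}_1,\mathbf{q}_2\in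 A$ and parameter $\alpha>0$, $2\alpha>\|\mathbf{q}_1-\mathbf{q}_2\|$, is $\{\mathbf{x}\in A:\|\mathbf{q}_2-\mathbf{x}\|+\|\mathbf{q}_1-\mathbf{x}\|=2\alpha\}$. - For both, the center is $\frac12(\mathbf{q}_1+\mathbf{q}_2)$, the axis vector is $\mathbf{w}=(\mathbf{q}_1-\mathbf{q}_2)/\|\mathbf{q}_1-\mathbf{q}_2\|$, the vertices are the center $\pm\,\alpha\mathbf{w}$, and the second parameter $\beta$ is $\sqrt{\gamma^2-\alpha^2}$ (hyperboloid) or $\sqrt{\alpha^2-\gamma^2}$ (ellipsoid), with $\gamma=\frac12\|\mathbf{q}_1-\mathbf{q}_2\|$. In the statement $\alpha=\hat a$ and $\beta=\hat b$. - The paraboloid determined by points $\mathbf{q}_1\neq\mathbf{q}_2$ in $A$ (called its focal points) is $\{\mathbf{x}\in A:\|\mathbf{q}_1-\mathbf{x}\|=\mathbf{w}\cdot(\mathbf{x}-\mathbf{q}_2)\}$, with axis vector $\mathbf{w}=(\mathbf{q}_1-\mathbf{q}_2)/\|\mathbf{q}_1-\mathbf{q}_2\|$ and center (vertex) $\frac12(\mathbf{q}_1+\mathbf{q}_2)$.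
   Formalization: The axis vector is g_1 only up to sign (for a paraboloid with σĥ<0 it is −g_1, so the claim as worded fails), and n≥3 is assumed, since for n=2 the sections are one or two points on a line, which do not determine focal points. *)

(* Defs.v *)
(* Uses Mathematical Components, over an arbitrary [R : realType]. *)
From mathcomp Require Export all_boot all_order all_algebra.
From mathcomp Require Export classical_sets reals.

Set Implicit Arguments.
Unset Strict Implicit.
Unset Printing Implicit Defensive.

Import Order.TTheory GRing.Theory Num.Theory.

Local Open Scope ring_scope.
Local Open Scope classical_set_scope.

Definition dot (R : realType) (n : nat) (u v : 'cV[R]_n) : R :=
  (u^T *m v) 0 0.

(* MathComp-Analysis equips matrices with the sup norm; this is the
   Euclidean one. *)
Definition enorm (R : realType) (n : nat) (u : 'cV[R]_n) : R :=
  Num.sqrt (dot u u).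

Definition normalize (R : realType) (n : nat) (u : 'cV[R]_n) : 'cV[R]_n :=
  (enorm u)^-1 *: u.

Definition hyperplane (R : realType) (n : nat) (h p : 'cV[R]_n) (k : R) :
    set 'cV[R]_n :=
  [set x | dot h (x - p) = k].

(* For [0 < a < c] and [v] of unit length: the two-sheeted hyperboloid of
   revolution with center [p], vertices [p +- a v] and focal points
   [p +- c v]. *)
Definition quadric (R : realType) (n : nat) (p v : 'cV[R]_n) (a c : R) :
    set 'cV[R]_n :=
  let eps := c / a in
  [set x | ((x - p)^T *m (1%:M - eps ^+ 2 *: (v *m v^T)) *m (x - p)) 0 0
           = a ^+ 2 - c ^+ 2].

Definition center (R : realType) (n : nat) (q1 q2 : 'cV[R]_n) : 'cV[R]_n :=
  2^-1 *: (q1 + q2).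

Definition axis (R : realType) (n : nat) (q1 q2 : 'cV[R]_n) : 'cV[R]_n :=
  normalize (q1 - q2).

Definition vertices (R : realType) (n : nat) (q1 q2 : 'cV[R]_n) (alpha : R) :
    set 'cV[R]_n :=
  [set center q1 q2 + alpha *: axis q1 q2;
       center q1 q2 - alpha *: axis q1 q2].

Definition half_focal_dist (R : realType) (n : nat) (q1 q2 : 'cV[R]_n) : R :=
  2^-1 * enorm (q1 - q2).

Definition hyperboloid_beta (R : realType) (n : nat)
    (q1 q2 : 'cV[R]_n) (alpha : R) : R :=
  Num.sqrt (half_focal_dist q1 q2 ^+ 2 - alpha ^+ 2).

Definition ellipsoid_beta (R : realType) (n : nat)
    (q1 q2 : 'cV[R]_n) (alpha : R) : R :=
  Num.sqrt (alpha ^+ 2 - half_focal_dist q1 q2 ^+ 2).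

(* In the next three predicates [A] is meant to be a hyperplane, and
   [S] is the conic section, of dimension one less than the ambient space. *)

Definition is_hyperboloid (R : realType) (n : nat) (A S : set 'cV[R]_n)
    (q1 q2 : 'cV[R]_n) (alpha : R) : Prop :=
  [/\ A q1, A q2, 0 < 2 * alpha < enorm (q1 - q2) &
      S = [set x | A x /\ `|enorm (q2 - x) - enorm (q1 - x)| = 2 * alpha]].

Definition is_ellipsoid (R : realType) (n : nat) (A S : set 'cV[R]_n)
    (q1 q2 : 'cV[R]_n) (alpha : R) : Prop :=
  [/\ A q1, A q2, 0 < alpha, enorm (q1 - q2) < 2 * alpha &
      S = [set x | A x /\ enorm (q2 - x) + enorm (q1 - x) = 2 * alpha]].

(* [q1] is the focus and [q2] its mirror image in the vertex, which lies on
   the directrix. *)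
Definition is_paraboloid (R : realType) (n : nat) (A S : set 'cV[R]_n)
    (q1 q2 : 'cV[R]_n) : Prop :=
  [/\ A q1, A q2, q1 <> q2 &
      S = [set x | A x /\ enorm (q1 - x) = dot (axis q1 q2) (x - q2)]].

(* Main.v *)
(* Write [v = sigma h + rho g1].  On the hyperplane, the quadric is the zero set
   of a quadratic polynomial [F] whose quadratic part is
   [|y|^2 - eps^2 rho^2 (g1 . y)^2].  Suppose the section is a conic with center
   [m] and axis [w].  In each plane [m + span(w, u)], with [u] a unit vector
   orthogonal to [h] and [w], [F] vanishes on a nondegenerate plane conic, so
   five of its points determine the coefficients of the restriction of [F] up
   to a factor.  The mixed coefficient gives [(g1 . w) (g1 . u) = 0] for all such
   [u], so [w] is parallel or orthogonal to [g1]; the orthogonal case is excluded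
   by a sign.  The remaining coefficients give the center, the eccentricity and
   the size of the conic. *)
Require Import Defs.
From mathcomp Require Import ring lra.

Set Implicit Arguments.
Unset Strict Implicit.
Unset Printing Implicit Defensive.

Import Order.TTheory GRing.Theory Num.Theory.

Local Open Scope ring_scope.
Local Open Scope classical_set_scope.

(** * The Euclidean dot product and norm *)

Lemma dotE (R : realType) n (u v : 'cV[R]_n) : dot u v = \sum_i u i 0 * v i 0.
Proof. by rewrite /dot mxE; apply: eq_bigr => i _; rewrite mxE. Qed.

Lemma dotC (R : realType) n (u v : 'cV[R]_n) : dot u v = dot v u.
Proof. by rewrite !dotE; apply: eq_bigr => i _; rewrite mulrC. Qed.

Lemma dotDr (R : realType) n (u v w : 'cV[R]_n) :
  dot u (v + w) = dot u v + dot u w.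
Proof. by rewrite /dot mulmxDr mxE. Qed.

Lemma dotZr (R : realType) n k (u v : 'cV[R]_n) :
  dot u (k *: v) = k * dot u v.
Proof. by rewrite /dot -scalemxAr mxE. Qed.

Lemma dotNr (R : realType) n (u v : 'cV[R]_n) : dot u (- v) = - dot u v.
Proof. by rewrite -scaleN1r dotZr mulN1r. Qed.

Lemma dotDl (R : realType) n (u v w : 'cV[R]_n) :
  dot (v + w) u = dot v u + dot w u.
Proof. by rewrite !(dotC _ u) dotDr. Qed.

Lemma dotZl (R : realType) n k (u v : 'cV[R]_n) :
  dot (k *: v) u = k * dot v u.
Proof. by rewrite !(dotC _ u) dotZr. Qed.

Lemma dotNl (R : realType) n (u v : 'cV[R]_n) : dot (- v) u = - dot v u.
Proof. by rewrite !(dotC _ u) dotNr. Qed.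

Definition dotL := (dotDl, dotDr, dotZl, dotZr, dotNl, dotNr).

Lemma dot_ge0 (R : realType) n (u : 'cV[R]_n) : 0 <= dot u u.
Proof. by rewrite dotE sumr_ge0 // => i _; rewrite -expr2 sqr_ge0. Qed.

Lemma dot_eq0 (R : realType) n (u : 'cV[R]_n) : (dot u u == 0) = (u == 0).
Proof.
apply/idP/eqP => [|->]; last by rewrite /dot mulmx0 mxE.
rewrite dotE psumr_eq0 => [/allP u0|i _]; last by rewrite -expr2 sqr_ge0.
apply/colP => i; rewrite mxE.
by have := u0 i (mem_index_enum _); rewrite /= mulf_eq0 orbb => /eqP.
Qed.

Lemma dot_gt0 (R : realType) n (u : 'cV[R]_n) : u != 0 -> 0 < dot u u.
Proof. by move=> u0; rewrite lt_def dot_eq0 u0 dot_ge0. Qed.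

Lemma enorm_ge0 (R : realType) n (u : 'cV[R]_n) : 0 <= enorm u.
Proof. exact: sqrtr_ge0. Qed.

Lemma sqr_enorm (R : realType) n (u : 'cV[R]_n) : enorm u ^+ 2 = dot u u.
Proof. by rewrite sqr_sqrtr ?dot_ge0. Qed.

Lemma enorm_eq0 (R : realType) n (u : 'cV[R]_n) : (enorm u == 0) = (u == 0).
Proof. by rewrite -dot_eq0 -sqr_enorm sqrf_eq0. Qed.

Lemma enormE (R : realType) n (u : 'cV[R]_n) (k : R) :
  dot u u = k ^+ 2 -> enorm u = `|k|.
Proof. by rewrite /enorm => ->; rewrite sqrtr_sqr. Qed.

Lemma enorm_normalize (R : realType) n (u : 'cV[R]_n) :
  enorm u *: normalize u = u.
Proof.
have [->|u0] := eqVneq u 0; first by rewrite /normalize !scaler0.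
by rewrite /normalize scalerA divff ?scale1r // enorm_eq0.
Qed.

Lemma dot_normalize (R : realType) n (u : 'cV[R]_n) :
  u != 0 -> dot (normalize u) (normalize u) = 1.
Proof.
rewrite -enorm_eq0 => u0; rewrite /normalize !dotL -sqr_enorm.
by field.
Qed.

(** * Focal points from center, half focal distance and axis *)

Lemma focus1E (R : realType) n (q1 q2 : 'cV[R]_n) :
  q1 = center q1 q2 + half_focal_dist q1 q2 *: axis q1 q2.
Proof.
rewrite /half_focal_dist -scalerA enorm_normalize.
by apply/colP => i; rewrite !mxE; field.
Qed.

Lemma focus2E (R : realType) n (q1 q2 : 'cV[R]_n) :
  q2 = center q1 q2 - half_focal_dist q1 q2 *: axis q1 q2.
Proof.
rewrite /half_focal_dist -scalerA enorm_normalize.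
by apply/colP => i; rewrite !mxE; field.
Qed.

(** * Test planes and the plane conics in them *)

(** The matrix with columns [h] and [g] has rank at most 2, so for [2 < n] its left kernel contains
    a nonzero row, which is then normalized. *)
Lemma orthonormal_complement (R : realType) n (h g : 'cV[R]_n) :
  (2 < n)%N -> exists u : 'cV[R]_n, [/\ dot u u = 1, dot h u = 0 & dot g u = 0].
Proof.
move=> n_gt2; pose M := row_mx h g.
have : kermx M != 0.
  rewrite kermx_eq0 /row_free neq_ltn (leq_ltn_trans (rank_leq_col M)) //.
case/rowV0Pn => x /sub_kermxP xM x0.
have : x *m h = 0 /\ x *m g = 0.
  by move: xM; rewrite mul_mx_row => /eqP; rewrite row_mx_eq0 => /andP[/eqP-> /eqP->].
case=> xh xg.
have dx y : x *m y = 0 -> dot y (normalize x^T) = 0.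
  by move=> xy; rewrite dotC /normalize dotZl /dot trmxK xy mxE mulr0.
exists (normalize x^T); split; [|exact: dx|exact: dx].
apply: dot_normalize; apply: contra_neq x0 => xT.
by rewrite -[x]trmxK xT trmx0.
Qed.

(* Five points [(r, s)] suffice: the vertices [(0, +-alpha)] and three of the
   points [(+-r0, +-k alpha)], with [k = 2^-1] (ellipse) or [k = 2]
   (hyperbola). *)
Lemma central_conic_coef (R : realType) (A B C D E F alpha e : R) :
  0 < alpha -> e != 1 ->
  (forall r s : R, r ^+ 2 = (1 - e) * (alpha ^+ 2 - s ^+ 2) ->
     A * r ^+ 2 + B * s ^+ 2 + 2 * C * r * s + 2 * D * r + 2 * E * s + F = 0) ->
  [/\ B = (1 - e) * A, C = 0, D = 0, E = 0 & F = - B * alpha ^+ 2].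
Proof.
move=> al0 e1 H.
(* [1 - k ^+ 2] must have the sign of [1 - e], so that the curve has a real point with
   [s = k * alpha] and [r != 0]. *)
have [k k0 kP] : exists2 k : R, 0 < k & 0 < (1 - e) * (1 - k ^+ 2).
  move: e1; rewrite neq_lt => /orP[e1|e1]; [exists 2^-1|exists 2] => //; nra.
have k1 : k ^+ 2 != 1.
  by apply/eqP => k1; move: kP; rewrite k1 subrr mulr0 ltxx.
pose N := (1 - e) * (1 - k ^+ 2).
pose r0 := alpha * Num.sqrt N.
have r0P : 0 < r0 by rewrite mulr_gt0 // sqrtr_gt0.
have r2 : r0 ^+ 2 = (1 - e) * (alpha ^+ 2 - (k * alpha) ^+ 2).
  by rewrite exprMn sqr_sqrtr ?(ltW kP) // /N; ring.
have H1 := H 0 alpha; have H2 := H 0 (- alpha).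
have H3 := H r0 (k * alpha); have H4 := H (- r0) (k * alpha).
have H5 := H r0 (- (k * alpha)).
have {}H1 := H1 ltac:(ring). have {}H2 := H2 ltac:(ring).
have {}H3 := H3 r2. rewrite sqrrN in H4. have {}H4 := H4 r2.
rewrite sqrrN in H5. have {}H5 := H5 r2.
have E0 : E = 0.
  have : alpha * E = 0 by lra.
  by move/eqP; rewrite mulf_eq0 gt_eqF //= => /eqP.
subst E.
have F0 : F = - B * alpha ^+ 2 by lra.
have CD : C * (k * alpha) + D = 0.
  have : r0 * (C * (k * alpha) + D) = 0 by lra.
  by move/eqP; rewrite mulf_eq0 gt_eqF //= => /eqP.
have CD' : - C * (k * alpha) + D = 0.
  have : r0 * (- C * (k * alpha) + D) = 0 by lra.
  by move/eqP; rewrite mulf_eq0 gt_eqF //= => /eqP.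
have D0 : D = 0 by lra.
have C0 : C = 0.
  have : (k * alpha) * C = 0 by lra.
  by move/eqP; rewrite mulf_eq0 gt_eqF ?mulr_gt0 //= => /eqP.
subst C D; split=> //.
(* With only [A], [B] and [F] left, the equation at [(r0, k * alpha)] factors, and [1 - k ^+ 2]
   cancels. *)
have : alpha ^+ 2 * ((1 - k ^+ 2) * ((1 - e) * A - B)) = 0.
  rewrite -[RHS]H3 r2 F0; ring.
move/eqP; rewrite mulf_eq0 gt_eqF ?exprn_gt0 //= mulf_eq0 !subr_eq0.
by rewrite eq_sym (negbTE k1) => /eqP.
Qed.

(** Putting [r = 2 * gamma * t] and [s = gamma * t ^+ 2] gives a polynomial of degree at most 4 in
    [t]; its zeros at [t = 0, 1, -1, 2, -2] force all coefficients to vanish. *)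
Lemma parabola_coef (R : realType) (A B C D E F gamma : R) :
  0 < gamma ->
  (forall r s : R, r ^+ 2 = 4 * gamma * s ->
     A * r ^+ 2 + B * s ^+ 2 + 2 * C * r * s + 2 * D * r + 2 * E * s + F = 0) ->
  [/\ B = 0, C = 0, D = 0, E = - 2 * A * gamma & F = 0].
Proof.
move=> g0 H.
have H0 := H 0 0 ltac:(ring).
have H1 := H (2 * gamma) gamma ltac:(ring).
have H2 := H (- 2 * gamma) gamma ltac:(ring).
have H3 := H (4 * gamma) (4 * gamma) ltac:(ring).
have H4 := H (- 4 * gamma) (4 * gamma) ltac:(ring).
have gK x : gamma * x = 0 -> x = 0.
  by move/eqP; rewrite mulf_eq0 gt_eqF //= => /eqP.
have F0 : F = 0 by lra.
have CD1 : C * gamma + D = 0 by apply: (gK); lra.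
have CD2 : 4 * C * gamma + D = 0 by apply: (gK); lra.
have D0 : D = 0 by lra.
have C0 : C = 0 by apply: (gK); lra.
have E1 : 4 * A * gamma + B * gamma + 2 * E = 0 by apply: (gK); lra.
have E2 : 2 * A * gamma + 2 * B * gamma + E = 0 by apply: (gK); lra.
have B0 : B = 0 by apply: (gK); lra.
by split => //; subst B; lra.
Qed.

(** Taylor expansion at [z], arranged to fit the two coefficient lemmas; [b d] is half the
    derivative along [d]. *)
Lemma quadratic_on_plane (R : realType) n (g z w u : 'cV[R]_n) (ka ta K r s : R) :
  dot w w = 1 -> dot u u = 1 -> dot w u = 0 ->
  let z' := z + s *: w + r *: u in
  dot z' z' - (ka + ta * dot g z') ^+ 2 = K ->
  let b d := dot z d - (ka + ta * dot g z) * ta * dot g d in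
  (1 - ta ^+ 2 * dot g u ^+ 2) * r ^+ 2 + (1 - ta ^+ 2 * dot g w ^+ 2) * s ^+ 2
  + 2 * (- ta ^+ 2 * (dot g w * dot g u)) * r * s + 2 * b u * r + 2 * b w * s
  + (dot z z - (ka + ta * dot g z) ^+ 2 - K) = 0.
Proof.
move=> ww uu wu z' <- b; rewrite /z' /b !dotL (dotC u w) (dotC u z) (dotC w z).
by rewrite ww uu wu; ring.
Qed.

(** * Locating the axis and the center *)

Lemma unit_collinear (R : realType) n (g w : 'cV[R]_n) :
  dot g g = 1 -> dot w w = 1 -> g = dot g w *: w -> w = g \/ w = - g.
Proof.
move=> gg ww gE.
have : dot g w ^+ 2 = 1 ^+ 2 by rewrite expr1n -[RHS]gg {3}gE dotZr expr2.
move/eqP; rewrite eqf_sqr => /orP[] /eqP gw.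
  by left; rewrite gE gw scale1r.
by right; rewrite gE gw scaleN1r opprK.
Qed.

(** If [d] were nonzero, its own normalization would be an admissible [u] with [dot d u] nonzero. *)
Lemma orthogonal_units_eq0 (R : realType) n (h g d : 'cV[R]_n) :
  dot h d = 0 -> dot g d = 0 ->
  (forall u, dot u u = 1 -> dot h u = 0 -> dot g u = 0 -> dot d u = 0) ->
  d = 0.
Proof.
move=> hd gd dP; apply/eqP/negPn/negP => d0.
have := dP (normalize d) (dot_normalize d0).
rewrite /normalize !dotZr hd gd mulr0 => /(_ erefl erefl)/eqP.
by rewrite mulf_eq0 invr_eq0 enorm_eq0 dot_eq0 (negbTE d0).
Qed.

(** The remainder of [z] after both projections is killed by [orthogonal_units_eq0]. This turns
    vanishing transverse derivatives into a formula for the center. *)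
Lemma orthonormal_decomposition (R : realType) n (h g z : 'cV[R]_n) :
  dot h h = 1 -> dot g g = 1 -> dot h g = 0 ->
  (forall u, dot u u = 1 -> dot h u = 0 -> dot g u = 0 -> dot z u = 0) ->
  z = dot h z *: h + dot g z *: g.
Proof.
move=> hh gg hg zP; apply/eqP; rewrite -subr_eq0; apply/eqP.
apply: (@orthogonal_units_eq0 _ _ h g) => [||u uu hu gu].
- by rewrite !dotL hh hg; ring.
- by rewrite !dotL gg (dotC g h) hg; ring.
- by rewrite !dotL zP // hu gu; ring.
Qed.

(** If [dot g w] is nonzero, every admissible [u] is orthogonal to [g], so the part of [g]
    orthogonal to [w] vanishes. *)
Lemma unit_collinear_or_orthogonal (R : realType) n (h g w : 'cV[R]_n) :
  dot g g = 1 -> dot w w = 1 -> dot h g = 0 -> dot h w = 0 ->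
  (forall u, dot u u = 1 -> dot h u = 0 -> dot w u = 0 ->
     dot g w * dot g u = 0) ->
  [\/ w = g, w = - g | dot g w = 0].
Proof.
move=> gg ww hg hw gwu.
have [gw|gw] := eqVneq (dot g w) 0; first by constructor 3.
suff gE : g - dot g w *: w = 0.
  by have [->|->] := unit_collinear gg ww (subr0_eq gE);
    [constructor 1|constructor 2].
apply: (@orthogonal_units_eq0 _ _ h w) => [||u uu hu wu].
- by rewrite !dotL hg hw; ring.
- by rewrite !dotL ww (dotC w g); ring.
- rewrite !dotL wu; have /eqP := gwu u uu hu wu.
  by rewrite mulf_eq0 (negbTE gw) => /eqP ->; ring.
Qed.


(* The lower bound on [K] excludes a hyperbola whose axis is orthogonal to
   [g]. *)
Lemma central_section (R : realType) n (g h w z : 'cV[R]_n)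
    (hhat ka ta K al e : R) :
  (2 < n)%N -> dot g g = 1 -> dot h h = 1 -> dot w w = 1 ->
  dot h g = 0 -> dot h w = 0 -> dot h z = hhat ->
  0 < ta -> 0 < al -> 0 <= e -> e != 1 ->
  (1 < ta ^+ 2 -> hhat ^+ 2 * (1 - ta ^+ 2) - ka ^+ 2 < K * (1 - ta ^+ 2)) ->
  (forall u, dot u u = 1 -> dot h u = 0 -> dot w u = 0 -> forall r s,
     r ^+ 2 = (1 - e) * (al ^+ 2 - s ^+ 2) ->
     let z' := z + s *: w + r *: u in
     dot z' z' - (ka + ta * dot g z') ^+ 2 = K) ->
  [/\ w = g \/ w = - g, e = ta ^+ 2,
      z = hhat *: h + (ka * ta / (1 - ta ^+ 2)) *: g &
      hhat ^+ 2 - ka ^+ 2 / (1 - ta ^+ 2) - K = - (1 - ta ^+ 2) * al ^+ 2].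
Proof.
move=> n_gt2 gg hh ww hg hw hz ta0 al0 e0 e1 Kbound H.
pose b d := dot z d - (ka + ta * dot g z) * ta * dot g d.
have coef u : dot u u = 1 -> dot h u = 0 -> dot w u = 0 ->
    [/\ 1 - ta ^+ 2 * dot g w ^+ 2 = (1 - e) * (1 - ta ^+ 2 * dot g u ^+ 2),
       - ta ^+ 2 * (dot g w * dot g u) = 0, b u = 0, b w = 0 &
       dot z z - (ka + ta * dot g z) ^+ 2 - K =
         - (1 - ta ^+ 2 * dot g w ^+ 2) * al ^+ 2].
  move=> uu hu wu; apply: (central_conic_coef al0 e1) => r s rs.
  exact: (quadratic_on_plane ww uu wu (H u uu hu wu r s rs)).
have wgP : [\/ w = g, w = - g | dot g w = 0].
  apply: unit_collinear_or_orthogonal gg ww hg hw _ => u uu hu wu.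
  have [_ /eqP + _ _ _] := coef u uu hu wu.
  by rewrite mulf_eq0 oppr_eq0 sqrf_eq0 gt_eqF //= => /eqP.
have {wgP} [wg|gw] : (w = g \/ w = - g) \/ dot g w = 0.
  by case: wgP; [left; left|left; right|right].
  have gw2 : dot g w ^+ 2 = 1.
    by case: wg => ->; rewrite ?dotNr gg ?sqrrN expr1n.
  have wu u : dot g u = 0 -> dot w u = 0.
    by case: wg => -> gu; rewrite ?dotNl gu ?oppr0.
  (* Along a [u] orthogonal to [g] the coefficient of [r ^+ 2] is 1, so that of [s ^+ 2] is
     [1 - e]. *)
  have [u [uu hu gu]] := orthonormal_complement h g n_gt2.
  have [Be _ _ bw F0] := coef u uu hu (wu u gu).
  have eta : e = ta ^+ 2 by move: Be; rewrite gw2 gu expr0n /=; lra.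
  have ta1 : 1 - ta ^+ 2 != 0 by rewrite -eta subr_eq0 eq_sym.
  (* The derivative along [g] vanishes at the center; as [ta ^+ 2 != 1], this linear equation
     determines [dot g z]. *)
  have bg : b g = 0.
    by case: wg bw => -> //; rewrite /b !dotNr mulrN opprK => ?; lra.
  have zE : z = hhat *: h + dot g z *: g.
    rewrite -hz; apply: orthonormal_decomposition => // x xx hx gx.
    have [_ _ + _ _] := coef x xx hx (wu x gx).
    by rewrite /b gx mulr0 subr0.
  have gzE : dot g z = ka * ta / (1 - ta ^+ 2).
    apply: (canRL (mulfK ta1)).
    by move: bg; rewrite /b (dotC z g) gg => ?; lra.
  split=> //; first by rewrite -gzE.
  have zz : dot z z = hhat ^+ 2 + dot g z ^+ 2.
    by rewrite {1 2}zE !dotL (dotC g h) hh gg hg; ring.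
  move: F0; rewrite gw2 zz gzE !mulr1 => <-; field.
  exact: ta1.
(* In the orthogonal case [g] itself is an admissible [u], and [Be] becomes
   [1 = (1 - e) * (1 - ta ^+ 2)]. *)
have [Be _ bg _ F0] := coef g gg hg ltac:(by rewrite dotC).
rewrite gw gg expr0n expr1n /= mulr0 subr0 mulr1 in Be F0.
have Mt : ka * ta = dot g z * (1 - ta ^+ 2).
  by move: bg; rewrite /b (dotC z g) gg => ?; lra.
have zz : hhat ^+ 2 + dot g z ^+ 2 <= dot z z.
  have := dot_ge0 (z - hhat *: h - dot g z *: g).
  rewrite !dotL (dotC z h) (dotC z g) (dotC g h) hh gg hg hz; lra.
exfalso.
set t := dot g z in Mt zz F0; set T := ta ^+ 2 in Kbound Mt Be.
have T0 : 0 < T by rewrite exprn_gt0.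
(* For [0 <= e < 1] and [T > 0] the product [(1 - e) * (1 - T)] stays below 1; for [e > 1] it can be
   1 only if [T > 1]. *)
case: (ltP e 1) => [e_lt1|]; first by nra.
rewrite le_eqVlt eq_sym (negbTE e1) /= => e_gt1.
have T1 : 1 < T by nra.
have := Kbound T1.
have -> : K = dot z z - (ka + ta * t) ^+ 2 + al ^+ 2 by lra.
rewrite ltNge => /negP; apply.
(* The last square vanishes by [Mt]. Since [1 - T < 0], the lower bound [zz] on [dot z z] then
   contradicts [Kbound]. *)
have -> : hhat ^+ 2 * (1 - T) - ka ^+ 2 =
   (hhat ^+ 2 + t ^+ 2 - (ka + ta * t) ^+ 2) * (1 - T)
   - (ka * ta - t * (1 - T)) ^+ 2.
  by rewrite /T; ring.
have : 0 < al ^+ 2 by rewrite exprn_gt0.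
by rewrite Mt subrr expr0n subr0; nra.
Qed.

(** The vanishing coefficient of [s ^+ 2] gives [ta ^+ 2 * dot g w ^+ 2 = 1], hence the axis and
    [ta = 1]. Then [dot g z] cancels from the coefficient of [s], which relates [ka] to [gamma]; the
    constant term gives [dot g z]. *)
Lemma parabolic_section (R : realType) n (g h w z : 'cV[R]_n)
    (hhat ka ta K gamma : R) :
  (2 < n)%N -> dot g g = 1 -> dot h h = 1 -> dot w w = 1 ->
  dot h g = 0 -> dot h w = 0 -> dot h z = hhat ->
  0 < ta -> 0 < gamma ->
  (forall u, dot u u = 1 -> dot h u = 0 -> dot w u = 0 -> forall r s,
     r ^+ 2 = 4 * gamma * s ->
     let z' := z + s *: w + r *: u in
     dot z' z' - (ka + ta * dot g z') ^+ 2 = K) ->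
  [/\ w = g \/ w = - g, ta = 1, ka != 0,
      gamma *: w = (ka / 2) *: g &
      z = hhat *: h + ((hhat ^+ 2 - ka ^+ 2 - K) / (2 * ka)) *: g].
Proof.
move=> n_gt2 gg hh ww hg hw hz ta0 gamma0 H.
pose b d := dot z d - (ka + ta * dot g z) * ta * dot g d.
have coef u : dot u u = 1 -> dot h u = 0 -> dot w u = 0 ->
    [/\ 1 - ta ^+ 2 * dot g w ^+ 2 = 0,
       - ta ^+ 2 * (dot g w * dot g u) = 0, b u = 0,
       b w = - 2 * (1 - ta ^+ 2 * dot g u ^+ 2) * gamma &
       dot z z - (ka + ta * dot g z) ^+ 2 - K = 0].
  move=> uu hu wu; apply: (parabola_coef gamma0) => r s rs.
  exact: (quadratic_on_plane ww uu wu (H u uu hu wu r s rs)).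
have wgP : [\/ w = g, w = - g | dot g w = 0].
  apply: unit_collinear_or_orthogonal gg ww hg hw _ => u uu hu wu.
  have [_ /eqP + _ _ _] := coef u uu hu wu.
  by rewrite mulf_eq0 oppr_eq0 sqrf_eq0 gt_eqF //= => /eqP.
have {wgP} wg : w = g \/ w = - g.
  case: wgP => [wg|wg|gw]; [by left|by right|exfalso].
  have [Be _ _ _ _] := coef g gg hg ltac:(by rewrite dotC).
  by move: Be; rewrite gw expr0n mulr0 subr0 => /eqP; rewrite oner_eq0.
have gw2 : dot g w ^+ 2 = 1.
  by case: wg => ->; rewrite ?dotNr gg ?sqrrN expr1n.
have wu u : dot g u = 0 -> dot w u = 0.
  by case: wg => -> gu; rewrite ?dotNl gu ?oppr0.
have [u [uu hu gu]] := orthonormal_complement h g n_gt2.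
have [Be _ _ bw F0] := coef u uu hu (wu u gu).
have ta1 : ta = 1.
  have /eqP : ta ^+ 2 = 1 by move: Be; rewrite gw2; lra.
  by rewrite sqrf_eq1 => /orP[] /eqP // ta1; move: ta0; rewrite ta1; lra.
have kagw : ka * dot g w = 2 * gamma.
  move: bw; rewrite /b gu ta1; case: wg => ->.
    by rewrite (dotC z) gg; lra.
  by rewrite !dotNr (dotC z) gg; lra.
have ka0 : ka != 0.
  by apply/eqP => ka0; move: kagw; rewrite ka0 mul0r => ?; lra.
have zE : z = hhat *: h + dot g z *: g.
  rewrite -hz; apply: orthonormal_decomposition => // x xx hx gx.
  have [_ _ + _ _] := coef x xx hx (wu x gx).
  by rewrite /b gx mulr0 subr0.
have zz : dot z z = hhat ^+ 2 + dot g z ^+ 2.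
  by rewrite {1 2}zE !dotL (dotC g h) hh gg hg; ring.
split=> //.
  have -> : gamma = ka * dot g w / 2 by rewrite kagw; field.
  by case: wg => ->; rewrite ?dotNr gg ?scalerN -?scaleNr; congr (_ *: _); field.
rewrite [LHS]zE; congr (_ + _ *: _).
move: F0; rewrite zz ta1 => F0.
have -> : hhat ^+ 2 - ka ^+ 2 - K = dot g z * (2 * ka) by lra.
by field.
Qed.

(** * Points of the conics defined by focal distances *)

(** Eliminating [r] makes the squared distance a perfect square. The formula serves ellipse and
    hyperbola alike, and the second focus through [- gamma]. *)
Lemma central_focal_distance (R : realType) n (m w u : 'cV[R]_n)
    (alpha gamma r s : R) :
  alpha != 0 -> dot w w = 1 -> dot u u = 1 -> dot w u = 0 ->
  r ^+ 2 = (1 - (gamma / alpha) ^+ 2) * (alpha ^+ 2 - s ^+ 2) ->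
  enorm (m + gamma *: w - (m + s *: w + r *: u)) =
  `|alpha - gamma * s / alpha|.
Proof.
move=> al0 ww uu wu rs; apply: enormE.
have -> : m + gamma *: w - (m + s *: w + r *: u) = (gamma - s) *: w - r *: u.
  by apply/colP => i; rewrite !mxE; ring.
rewrite !dotL (dotC u w) ww uu wu.
transitivity ((gamma - s) ^+ 2 + r ^+ 2); first by ring.
by rewrite rs; field.
Qed.

Lemma enorm_focal (R : realType) n (m w : 'cV[R]_n) (gamma : R) :
  dot w w = 1 -> 0 <= gamma ->
  enorm (m + gamma *: w - (m - gamma *: w)) = 2 * gamma.
Proof.
move=> ww g0; rewrite -[RHS]ger0_norm ?mulr_ge0 //; apply: enormE.
have -> : m + gamma *: w - (m - gamma *: w) = (2 * gamma) *: w.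
  by apply/colP => i; rewrite !mxE; ring.
by rewrite !dotL ww; ring.
Qed.

(** With [z = gamma * s / alpha] the focal distances are the absolute values of [alpha - z] and
    [alpha + z]; as [z] has absolute value at least [alpha], they differ by [2 * alpha] on either
    sheet. *)
Lemma hyperboloid_points (R : realType) n (A S : set 'cV[R]_n)
    (m w : 'cV[R]_n) (alpha gamma : R) :
  is_hyperboloid A S (m + gamma *: w) (m - gamma *: w) alpha ->
  dot w w = 1 -> 0 <= gamma ->
  [/\ 0 < alpha, (gamma / alpha) ^+ 2 != 1 &
      forall u, dot u u = 1 -> dot w u = 0 -> forall r s,
        r ^+ 2 = (1 - (gamma / alpha) ^+ 2) * (alpha ^+ 2 - s ^+ 2) ->
        A (m + s *: w + r *: u) -> S (m + s *: w + r *: u)].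
Proof.
case=> _ _ + -> ww g0; rewrite enorm_focal // => /andP[al0 alg].
have {}al0 : 0 < alpha by lra.
have e1 : 1 < (gamma / alpha) ^+ 2.
  by rewrite expr_gt1 ?ltr_pdivlMr ?divr_ge0 ?(ltW al0) // mul1r; lra.
split=> //; first by rewrite gt_eqF.
move=> u uu wu r s rs Ax; split=> //.
rewrite -scaleNr !(@central_focal_distance _ _ _ _ _ alpha) //;
  rewrite ?gt_eqF ?mulNr ?sqrrN //.
set z := gamma * s / alpha; rewrite opprK.
have zal : alpha ^+ 2 <= z ^+ 2.
  have -> : z ^+ 2 = (gamma / alpha) ^+ 2 * s ^+ 2 by rewrite /z; field; rewrite gt_eqF.
  (* [r ^+ 2] is nonnegative while its factor [1 - (gamma / alpha) ^+ 2] is negative. *)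
  have ss : alpha ^+ 2 <= s ^+ 2.
    by have := sqr_ge0 r; rewrite rs nmulr_rge0 ?subr_lt0 // subr_le0.
  by rewrite (le_trans ss) // ler_peMl ?sqr_ge0 // ltW.
have [z0|z0] := leP 0 z.
  have zal' : alpha <= z by nra.
  by rewrite (@ger0_norm _ (alpha + z)) ?(@ler0_norm _ (alpha - z)) ?ger0_norm; lra.
have zal' : z <= - alpha by nra.
by rewrite (@ler0_norm _ (alpha + z)) ?(@ger0_norm _ (alpha - z)) ?ler0_norm; lra.
Qed.

(** Here [z] has absolute value at most [alpha], so the distances are [alpha - z] and [alpha + z],
    with sum [2 * alpha]. *)
Lemma ellipsoid_points (R : realType) n (A S : set 'cV[R]_n)
    (m w : 'cV[R]_n) (alpha gamma : R) :
  is_ellipsoid A S (m + gamma *: w) (m - gamma *: w) alpha ->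
  dot w w = 1 -> 0 <= gamma ->
  [/\ 0 < alpha, (gamma / alpha) ^+ 2 != 1 &
      forall u, dot u u = 1 -> dot w u = 0 -> forall r s,
        r ^+ 2 = (1 - (gamma / alpha) ^+ 2) * (alpha ^+ 2 - s ^+ 2) ->
        A (m + s *: w + r *: u) -> S (m + s *: w + r *: u)].
Proof.
case=> _ _ al0 + -> ww g0; rewrite enorm_focal // => alg.
have e1 : (gamma / alpha) ^+ 2 < 1.
  by rewrite expr_lt1 ?ltr_pdivrMr ?divr_ge0 ?(ltW al0) // mul1r; lra.
split=> //; first by rewrite lt_eqF.
move=> u uu wu r s rs Ax; split=> //.
rewrite -scaleNr !(@central_focal_distance _ _ _ _ _ alpha) //;
  rewrite ?gt_eqF ?mulNr ?sqrrN //.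
set z := gamma * s / alpha; rewrite opprK.
have zal : z ^+ 2 <= alpha ^+ 2.
  have -> : z ^+ 2 = (gamma / alpha) ^+ 2 * s ^+ 2 by rewrite /z; field; rewrite gt_eqF.
  have ss : s ^+ 2 <= alpha ^+ 2.
    by have := sqr_ge0 r; rewrite rs pmulr_rge0 ?subr_gt0 // subr_ge0.
  by rewrite (le_trans _ ss) // ler_piMl ?sqr_ge0 // ltW.
by rewrite !ger0_norm; [ring|nra|nra].
Qed.

(** Both sides of the focal equation equal [s + gamma], because [(gamma - s) ^+ 2 + 4 * gamma * s]
    is its square and [s >= 0]. *)
Lemma paraboloid_points (R : realType) n (A S : set 'cV[R]_n)
    (q1 q2 : 'cV[R]_n) :
  let m := center q1 q2 in
  let w := axis q1 q2 in
  let gamma := half_focal_dist q1 q2 in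
  is_paraboloid A S q1 q2 ->
  [/\ dot w w = 1, 0 < gamma &
      forall u, dot u u = 1 -> dot w u = 0 -> forall r s,
        r ^+ 2 = 4 * gamma * s ->
        A (m + s *: w + r *: u) -> S (m + s *: w + r *: u)].
Proof.
move=> m w gamma [_ _ /eqP q12 ->].
have q12' : q1 - q2 != 0 by rewrite subr_eq0.
have ww : dot w w = 1 by exact: dot_normalize.
have g0 : 0 < gamma.
  by rewrite mulr_gt0 ?invr_gt0 // lt_def enorm_ge0 enorm_eq0 q12'.
split=> // u uu wu r s rs Ax; split=> //.
have s0 : 0 <= s.
  have g4 : 0 < 4 * gamma by rewrite mulr_gt0.
  by rewrite -(pmulr_rge0 s g4) -rs sqr_ge0.
have x2 : m + s *: w + r *: u - q2 = (s + gamma) *: w + r *: u.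
  rewrite [q2 in LHS](focus2E q1 q2) -/m -/w -/gamma.
  by apply/colP => i; rewrite !mxE; ring.
have x1 : q1 - (m + s *: w + r *: u) = (gamma - s) *: w - r *: u.
  rewrite [q1 in LHS](focus1E q1 q2) -/m -/w -/gamma.
  by apply/colP => i; rewrite !mxE; ring.
rewrite -/w x1 x2; clearbody w; rewrite [RHS]dotDr !dotZr ww wu mulr1 mulr0 addr0.
rewrite -[RHS]ger0_norm; last by lra.
apply: enormE.
rewrite !dotL (dotC u w) ww uu wu.
transitivity ((gamma - s) ^+ 2 + r ^+ 2); first by ring.
by rewrite rs; ring.
Qed.

(** * The quadric in coordinates adapted to the hyperplane *)

Lemma quadricE (R : realType) n (p v x : 'cV[R]_n) (a c : R) :
  quadric p v a c x ->
  dot (x - p) (x - p) - (c / a * dot v (x - p)) ^+ 2 = a ^+ 2 - c ^+ 2.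
Proof.
rewrite /quadric /=; move: (x - p) => z <-.
rewrite mulmxBr mulmx1 mulmxBl -scalemxAr -scalemxAl.
rewrite [RHS]mxE [X in _ = _ + X]mxE [X in _ = _ - X]mxE.
have -> : (z^T *m (v *m v^T) *m z) 0 0 = dot z v * dot v z.
  by rewrite mulmxA -mulmxA [LHS]mxE big_ord1.
by rewrite -/(dot z z) (dotC z v); ring.
Qed.

(** Pythagoras; positivity is strict because independence keeps [v] off the line of [h]. *)
Lemma dot_rejection (R : realType) n (h v : 'cV[R]_n) :
  dot v v = 1 -> dot h h = 1 -> free [:: h; v] ->
  dot (v - dot v h *: h) (v - dot v h *: h) = 1 - dot h v ^+ 2 /\
  0 < 1 - dot h v ^+ 2.
Proof.
move=> vv hh fr.
have dd : dot (v - dot v h *: h) (v - dot v h *: h) = 1 - dot h v ^+ 2.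
  by rewrite !dotL vv hh (dotC v h); ring.
split=> //; rewrite -dd; apply: dot_gt0; rewrite subr_eq0.
apply: contraTneq fr => vE.
rewrite (perm_free (_ : perm_eq [:: h; v] [:: v; h])).
  by rewrite free_cons span_seq1 vE memvZ // memv_line.
by rewrite -cat1s -[X in perm_eq _ X]cat1s perm_catC.
Qed.

Lemma dot_unit (R : realType) n (u : 'cV[R]_n) : enorm u = 1 -> dot u u = 1.
Proof. by rewrite -sqr_enorm => ->; rewrite expr1n. Qed.

Lemma slice_coordinates (R : realType) n (h v : 'cV[R]_n) :
  enorm v = 1 -> enorm h = 1 -> free [:: h; v] ->
  let rho := Num.sqrt (1 - dot h v ^+ 2) in
  let g := normalize (v - dot v h *: h) in
  [/\ dot g g = 1, dot h g = 0, 0 < rho,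
      rho ^+ 2 = 1 - dot h v ^+ 2 & v = dot h v *: h + rho *: g].
Proof.
move=> v1 h1 fr rho g.
have vv := dot_unit v1; have hh := dot_unit h1.
have [dd s1] := dot_rejection vv hh fr.
have d0 : v - dot v h *: h != 0 by rewrite -dot_eq0 dd gt_eqF.
split=> //; first exact: dot_normalize.
- by rewrite /g /normalize !dotL hh (dotC v h); ring.
- by rewrite sqrtr_gt0.
- by rewrite sqr_sqrtr // ltW.
have -> : rho = enorm (v - dot v h *: h) by rewrite /enorm dd.
by rewrite enorm_normalize (dotC v h) addrC subrK.
Qed.

(** On the hyperplane [dot h z] is the constant [k], so [c / a * dot v z] is affine in [dot g z].
    This is the form [ka + ta * dot g z] of the section lemmas. *)
Lemma slice_quadric (R : realType) n (p v h g x : 'cV[R]_n) (a c k rho : R) :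
  v = dot h v *: h + rho *: g ->
  (hyperplane h p k `&` quadric p v a c) x ->
  let z := x - p in
  dot z z - (c / a * dot h v * k + c / a * rho * dot g z) ^+ 2 = a ^+ 2 - c ^+ 2.
Proof.
move=> vE [hx /quadricE <-] z; congr (_ - _ ^+ 2).
by rewrite [in RHS]vE dotDl !dotZl hx -/z; ring.
Qed.

(** * Sections of the quadric by the hyperplane *)

(** This is [central_section] in coordinates centered at [p], with [ka = eps * sigma * k],
    [ta = eps * rho], [K = a ^+ 2 - c ^+ 2] and [e] the squared eccentricity of the section. *)
Lemma central_slice (R : realType) n (a c k alpha : R)
    (p v h q1 q2 : 'cV[R]_n) :
  (2 < n)%N -> 0 < a -> a < c ->
  enorm v = 1 -> enorm h = 1 -> free [:: h; v] ->
  let eps := c / a in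
  let HP := hyperplane h p k in
  let S := HP `&` quadric p v a c in
  let sigma := dot h v in
  let rho := Num.sqrt (1 - sigma ^+ 2) in
  let g := normalize (v - dot v h *: h) in
  let E := eps ^+ 2 * rho ^+ 2 in
  is_hyperboloid HP S q1 q2 alpha \/ is_ellipsoid HP S q1 q2 alpha ->
  [/\ axis q1 q2 = g \/ axis q1 q2 = - g, 0 < alpha,
      half_focal_dist q1 q2 = alpha * eps * rho,
      center q1 q2 = p + k *: h + (eps ^+ 2 * rho * sigma * k / (1 - E)) *: g &
      alpha ^+ 2 =
        (1 - eps ^+ 2) * (a ^+ 2 * (1 - E) - k ^+ 2) / (1 - E) ^+ 2].
Proof.
move=> n_gt2 a0 ac v1 h1 fr eps HP S sigma rho g E SP.
have hh := dot_unit h1.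
have [gg hg rho0 rho2 vE] := slice_coordinates v1 h1 fr.
rewrite -/rho -/sigma -/g in gg hg rho0 rho2 vE.
have eps0 : 0 < eps by rewrite divr_gt0 // (lt_trans a0).
have eps1 : 1 < eps by rewrite ltr_pdivlMr // mul1r.
have [Aq1 Aq2] : HP q1 /\ HP q2 by case: SP; case.
(* If [q1 = q2] then [axis q1 q2] has the junk value 0.  Taking [w := g] instead,
   the comparison of eccentricities below excludes this case. *)
have [w [ww hw wE q1w q2w]] : exists w : 'cV[R]_n,
    [/\ dot w w = 1, dot h w = 0, half_focal_dist q1 q2 = 0 \/ axis q1 q2 = w,
        q1 = center q1 q2 + half_focal_dist q1 q2 *: w &
        q2 = center q1 q2 - half_focal_dist q1 q2 *: w].
  have [q12|q12] := eqVneq q1 q2.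
    have f0 : half_focal_dist q1 q2 = 0.
      by apply/eqP; rewrite /half_focal_dist q12 mulf_eq0 enorm_eq0 subrr eqxx orbT.
    exists g; split=> //; first by left.
      by rewrite {1}[q1 in LHS](focus1E q1 q2) f0 !scale0r.
    by rewrite {1}[q2 in LHS](focus2E q1 q2) f0 !scale0r.
  exists (axis q1 q2); split; [| |by right|exact: focus1E|exact: focus2E].
    by apply: dot_normalize; rewrite subr_eq0.
  move: Aq1 Aq2; rewrite /HP /hyperplane /axis /normalize /= !dotL => A1 A2.
  have -> : dot h q1 = dot h q2 by lra.
  by ring.
set m := center q1 q2 in q1w q2w *; set gam := half_focal_dist q1 q2 in wE q1w q2w *.
have gam0 : 0 <= gam by rewrite mulr_ge0 ?invr_ge0 ?enorm_ge0.
have [al0 e1 pts] : [/\ 0 < alpha, (gam / alpha) ^+ 2 != 1 &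
      forall u, dot u u = 1 -> dot w u = 0 -> forall r s,
        r ^+ 2 = (1 - (gam / alpha) ^+ 2) * (alpha ^+ 2 - s ^+ 2) ->
        HP (m + s *: w + r *: u) -> S (m + s *: w + r *: u)].
  rewrite q1w q2w in SP.
  by case: SP => [/hyperboloid_points|/ellipsoid_points]; apply.
have hm : dot h (m - p) = k.
  by move: Aq1 Aq2; rewrite /HP /hyperplane /= /m /center !dotL => A1 A2; lra.
have er2 : (eps * rho) ^+ 2 = eps ^+ 2 * rho ^+ 2 by ring.
have ka2 : (eps * sigma * k) ^+ 2 = eps ^+ 2 * (1 - rho ^+ 2) * k ^+ 2.
  by rewrite rho2; ring.
have [] := @central_section _ _ g h w (m - p) k (eps * sigma * k) (eps * rho)
  (a ^+ 2 - c ^+ 2) alpha ((gam / alpha) ^+ 2) n_gt2 gg hh ww hg hw hm.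
- exact: mulr_gt0.
- exact: al0.
- exact: sqr_ge0.
- exact: e1.
(* The bound on [K]: the difference of its sides factors into two terms, positive as [eps > 1] and
   [eps * rho > 1]. *)
- have -> : a ^+ 2 - c ^+ 2 = a ^+ 2 * (1 - eps ^+ 2).
    by rewrite /eps; field; rewrite gt_eqF.
  move=> T1; rewrite er2 ka2 -subr_gt0; rewrite er2 in T1.
  have -> : a ^+ 2 * (1 - eps ^+ 2) * (1 - eps ^+ 2 * rho ^+ 2) -
     (k ^+ 2 * (1 - eps ^+ 2 * rho ^+ 2) - eps ^+ 2 * (1 - rho ^+ 2) * k ^+ 2) =
     (eps ^+ 2 - 1) * (a ^+ 2 * (eps ^+ 2 * rho ^+ 2 - 1) + k ^+ 2) by ring.
  rewrite mulr_gt0 ?subr_gt0 ?expr_gt1 ?(ltW eps0) //.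
  by rewrite ltr_pwDl ?sqr_ge0 // mulr_gt0 ?exprn_gt0 // subr_gt0.
- move=> u uu hu wu r s rs.
  have -> : m - p + s *: w + r *: u = m + s *: w + r *: u - p.
    by apply/colP => i; rewrite !mxE; ring.
  apply: (slice_quadric vE); apply: pts rs _ => //.
  rewrite /HP /hyperplane /=.
  have -> : m + s *: w + r *: u - p = m - p + s *: w + r *: u.
    by apply/colP => i; rewrite !mxE; ring.
  by rewrite dotDr dotDr hm !dotZr hw hu; ring.
move=> wg gamE zE alE.
have M0 : 1 - E != 0 by rewrite /E -er2 -gamE subr_eq0 eq_sym.
have gamE' : gam = alpha * eps * rho.
  have er0 : 0 <= eps * rho by rewrite ltW // mulr_gt0.
  have ga0 : 0 <= gam / alpha by rewrite divr_ge0 // ltW.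
  have ge : gam / alpha = eps * rho.
    by apply/eqP; rewrite -(eqrXn2 (isT : 0 < 2)%N ga0 er0) gamE.
  by rewrite -mulrA -ge; field; rewrite gt_eqF.
split=> //.
- case: wE => [g0|->] //.
  by have := mulr_gt0 (mulr_gt0 al0 eps0) rho0; rewrite -gamE' g0 ltxx.
- rewrite -[LHS](subrK p) zE addrC addrA; congr (_ + _ *: _).
  by rewrite er2 -/E; field; exact: M0.
(* In terms of [eps], [a] and [E], the two terms in [k ^+ 2] of [alE] combine to
   [(1 - eps ^+ 2) * k ^+ 2 / (1 - E)]. *)
have cE : c = eps * a by rewrite /eps; field; rewrite gt_eqF.
have eE : eps ^+ 2 * (1 - rho ^+ 2) = eps ^+ 2 - E by rewrite /E; ring.
rewrite er2 ka2 -/E eE cE in alE.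
apply: (mulfI M0); rewrite -[LHS]opprK -mulNr -alE; field.
exact: M0.
Qed.

(** Half distance times axis is kept as one vector: the sign of the axis is that of [ctilde], so the
    order of the two focal points is determined. *)
Lemma parabolic_slice (R : realType) n (a c k : R) (p v h q1 q2 : 'cV[R]_n) :
  (2 < n)%N -> 0 < a -> a < c ->
  enorm v = 1 -> enorm h = 1 -> free [:: h; v] ->
  let eps := c / a in
  let HP := hyperplane h p k in
  let sigma := dot h v in
  let g := normalize (v - dot v h *: h) in
  let ctilde := eps * sigma * k / 2 in
  is_paraboloid HP (HP `&` quadric p v a c) q1 q2 ->
  [/\ axis q1 q2 = g \/ axis q1 q2 = - g,
      half_focal_dist q1 q2 *: axis q1 q2 = ctilde *: g &
      center q1 q2 = p + k *: h +
        (((1 - eps ^+ 2 * sigma ^+ 2) * k ^+ 2 - (a ^+ 2 - c ^+ 2)) /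
         (4 * ctilde)) *: g].
Proof.
move=> n_gt2 a0 ac v1 h1 fr eps HP sigma g ctilde SP.
have hh := dot_unit h1.
have [gg hg rho0 rho2 vE] := slice_coordinates v1 h1 fr.
set rho := Num.sqrt _ in rho0 rho2 vE; rewrite -/sigma -/g in gg hg rho2 vE.
have eps0 : 0 < eps by rewrite divr_gt0 // (lt_trans a0).
have [Aq1 Aq2] : HP q1 /\ HP q2 by case: SP.
have [ww gam0 pts] := paraboloid_points SP.
have hw : dot h (axis q1 q2) = 0.
  move: Aq1 Aq2; rewrite /HP /hyperplane /axis /normalize /= !dotL => A1 A2.
  have -> : dot h q1 = dot h q2 by lra.
  by ring.
have hm : dot h (center q1 q2 - p) = k.
  by move: Aq1 Aq2; rewrite /HP /hyperplane /= /center !dotL => A1 A2; lra.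
move: (axis q1 q2) (center q1 q2) (half_focal_dist q1 q2)
  => w m gam in ww gam0 pts hw hm *.
have [] := @parabolic_section _ _ g h w (m - p) k (eps * sigma * k) (eps * rho)
  (a ^+ 2 - c ^+ 2) gam n_gt2 gg hh ww hg hw hm.
- exact: mulr_gt0.
- exact: gam0.
- move=> u uu hu wu r s rs.
  have -> : m - p + s *: w + r *: u = m + s *: w + r *: u - p.
    by apply/colP => i; rewrite !mxE; ring.
  apply: (slice_quadric vE); apply: pts rs _ => //.
  rewrite /HP /hyperplane /=.
  have -> : m + s *: w + r *: u - p = m - p + s *: w + r *: u.
    by apply/colP => i; rewrite !mxE; ring.
  by rewrite dotDr dotDr hm !dotZr hw hu; ring.
move=> wg _ ka0 gamE zE; split=> //.
rewrite -[LHS](subrK p) zE addrC addrA; congr (_ + _ *: _).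
(* [4 * ctilde] is [2 * ka], nonzero by [ka0], so the division is genuine. *)
rewrite /ctilde -/sigma; move: ka0; set ka := eps * sigma * k => ka0.
have -> : (1 - eps ^+ 2 * sigma ^+ 2) * k ^+ 2 = k ^+ 2 - ka ^+ 2.
  by rewrite /ka; ring.
by field.
Qed.

Theorem corollary12 (R : realType) (n : nat) (n_gt2 : (2 < n)%N)
    (a c : R) (a_gt0 : 0 < a) (a_lt_c : a < c)
    (p v h : 'cV[R]_n) (hhat : R)
    (v_unit : enorm v = 1) (h_unit : enorm h = 1)
    (hv_free : free [:: h; v]) :
  let eps := c / a in
  let Q := quadric p v a c in
  let HP := hyperplane h p hhat in
  let sigma := dot h v in
  let rho := Num.sqrt (1 - sigma ^+ 2) in
  let g1 := normalize (v - dot v h *: h) in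
  (forall (q1 q2 : 'cV[R]_n) (ahat : R),
     is_hyperboloid HP (HP `&` Q) q1 q2 ahat \/
     is_ellipsoid HP (HP `&` Q) q1 q2 ahat ->
     let ctilde :=
       eps ^+ 2 * rho * sigma * hhat / (1 - eps ^+ 2 * rho ^+ 2) in
     let chat := p + hhat *: h + ctilde *: g1 in
     let btilde := ahat ^+ 2 * (1 - eps ^+ 2 * rho ^+ 2) in
     [/\ axis q1 q2 = g1 \/ axis q1 q2 = - g1,
         center q1 q2 = chat,
         vertices q1 q2 ahat = [set chat + ahat *: g1; chat - ahat *: g1],
         [set q1; q2] = [set chat + (ahat * eps * rho) *: g1;
                             chat - (ahat * eps * rho) *: g1] &
      [/\ ahat ^+ 2 =
            (1 - eps ^+ 2) *
            (a ^+ 2 * (1 - eps ^+ 2 * rho ^+ 2) - hhat ^+ 2) /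
            (1 - eps ^+ 2 * rho ^+ 2) ^+ 2,
          is_hyperboloid HP (HP `&` Q) q1 q2 ahat ->
            hyperboloid_beta q1 q2 ahat ^+ 2 = - btilde &
          is_ellipsoid HP (HP `&` Q) q1 q2 ahat ->
            ellipsoid_beta q1 q2 ahat ^+ 2 = btilde]]) /\
  (forall q1 q2 : 'cV[R]_n,
     is_paraboloid HP (HP `&` Q) q1 q2 ->
     let ctilde := eps * sigma * hhat / 2 in
     let chatcoef :=
       ((1 - eps ^+ 2 * sigma ^+ 2) * hhat ^+ 2 - (a ^+ 2 - c ^+ 2)) /
       (4 * ctilde) in
     let chat := p + hhat *: h + chatcoef *: g1 in
     [/\ axis q1 q2 = g1 \/ axis q1 q2 = - g1,
         center q1 q2 = chat,
         q1 = chat + ctilde *: g1 &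
         q2 = chat - ctilde *: g1]).
Proof.
move=> eps Q HP sigma rho g1; split=> [q1 q2 ahat qP ctilde chat btilde|].
  have [axE a0 gamE cE aE] :=
    central_slice n_gt2 a_gt0 a_lt_c v_unit h_unit hv_free qP.
  rewrite -/eps -/sigma -/rho -/g1 -/ctilde -/chat in axE gamE cE aE.
  have gamE2 : half_focal_dist q1 q2 ^+ 2 = ahat ^+ 2 * (eps ^+ 2 * rho ^+ 2).
    by rewrite gamE; ring.
  have gam0 : 0 <= half_focal_dist q1 q2 by rewrite mulr_ge0 ?invr_ge0 ?enorm_ge0.
  split=> //.
  (* Reversing the axis only exchanges the two points of the unordered pair; likewise for the
     foci. *)
  - rewrite /vertices cE; case: axE => -> //.
    by rewrite scalerN opprK setUC.
  - rewrite [in LHS](focus1E q1 q2) [in X in [set _; X]](focus2E q1 q2) cE gamE.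
    by case: axE => -> //; rewrite scalerN opprK setUC.
  (* [Num.sqrt] is 0 on negative numbers, so each radicand must be shown nonnegative; the focal
     inequality [lt12] does this. *)
  split=> // [[_ _ /andP[_ lt12] _]|[_ _ _ lt12 _]].
  - rewrite /hyperboloid_beta sqr_sqrtr gamE2 /btilde; first by ring.
    rewrite -gamE2 subr_ge0 ler_sqr ?nnegrE ?(ltW a0) //.
    by rewrite /half_focal_dist; lra.
  - rewrite /ellipsoid_beta sqr_sqrtr gamE2 /btilde; first by ring.
    rewrite -gamE2 subr_ge0 ler_sqr ?nnegrE ?(ltW a0) //.
    by rewrite /half_focal_dist; lra.
move=> q1 q2 qP ctilde chatcoef chat.
have [axE gamE cE] :=
  parabolic_slice n_gt2 a_gt0 a_lt_c v_unit h_unit hv_free qP.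
rewrite -/eps -/sigma -/ctilde -/chatcoef -/g1 -/chat in axE gamE cE.
split=> //.
- by rewrite {1}(focus1E q1 q2) cE gamE.
- by rewrite {1}(focus2E q1 q2) cE gamE.
Qed.
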